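(* Let $X$ be a set of alternatives with $|X| = m = 3$ and let $N=\{1,\dots,n\}$ with $n\ge 2$. Let $G: L(X)^N \to 2^X\setminus\{\varnothing\}$ be a social choice correspondence satisfying all of: (1) the Pareto condition; (2) tops-in; (3) balancedness. Then $G = G_P$, the Pareto correspondence.
   Context: $X$ is a finite set of alternatives with $|X|=m$, and $N=\{1,\dots,n\}$ is the set of individuals. $L(X)$ is the set of all (strong) orderings on $X$, i.e. complete, asymmetric, transitive relations (strict linear orders; no non-trivial indifference). For an ordering $r$, $r[1]$ denotes its top-ranked element. A profile is an element $u=(u(1),\dots,u(n))$ of $L(X)^N$; write $x\succ_i^u y$ if $x$ ranks above $y$ in $u(i)$. A social choice correspondence is a map $G$ from $L(X)^N$ to the non-empty subsets of $X$. At profile $u$, $x$ Pareto dominates $y$ if $x\succ_i^u y$ for all $i\in N$. The Pareto correspondence is $G_P(u)=\{x\in X: \text{no } y\in X \text{ Pareto dominates } x \text{ at } u\}$. Pareto condition: for all $x,y\in X$ and all profiles $u$, if $x$ Pareto dominates $y$ at $u$ then $y\notin G(u)$. Tops-in: $T(u)\subseteq G(u)$ for all profiles $u$, where $T(u)=\{x\in X: x=u(i)[1] \text{ for some } i\in N\}$. Balancedness: profile $v$ is constructed from profile $u$ by transposition pair $(x,y)$ via individuals $i$ and $j$ if at $u$, $x$ is immediately above $y$ for $i$ and $y$ is immediately above $x$ for $j$, and $v$ is the same as $u$ except that $x$ and $y$ are transposed for $i$ and for $j$. $G$ is balanced if, for all $x,y,u,v,i,j$, whenever $v$ is constructed from $u$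 by transposition pair $(x,y)$ via individuals $i$ and $j$, then $G(v)=G(u)$. *)

(* Defs.v *)
From HB Require Import structures.
From mathcomp Require Import all_boot all_fingroup.
Set Implicit Arguments.
Unset Strict Implicit.
Unset Printing Implicit Defensive.

Section Orderings.
Variable X : finType.

(* A relation is encoded as its graph; [(x, y) \in r] reads "x ranks above y".
   Completeness is only required of distinct pairs: with asymmetry, this makes
   [r] a strict linear order. *)
Definition complete_rel (r : {set X * X}) : bool :=
  [forall x, forall y, (x != y) ==> ((x, y) \in r) || ((y, x) \in r)].

Definition asymmetric_rel (r : {set X * X}) : bool :=
  [forall x, forall y, ((x, y) \in r) ==> ((y, x) \notin r)].

Definition transitive_rel (r : {set X * X}) : bool :=
  [forall x, forall y, forall z,
     ((x, y) \in r) && ((y, z) \in r) ==> ((x, z) \in r)].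

Definition strong_ordering (r : {set X * X}) : bool :=
  [&& complete_rel r, asymmetric_rel r & transitive_rel r].

Definition ordering : Type := {r : {set X * X} | strong_ordering r}.

Definition above (r : ordering) (x y : X) : bool := (x, y) \in val r.

Definition top_ranked (r : ordering) (x : X) : bool :=
  [forall y, (y != x) ==> above r x y].

Definition immediately_above (r : ordering) (x y : X) : bool :=
  above r x y && ~~ [exists z, above r x z && above r z y].

(* The graph of the relation obtained from [r] by exchanging the positions of
   [x] and [y]. *)
Definition transpose (x y : X) (r : {set X * X}) : {set X * X} :=
  [set p | (tperm x y p.1, tperm x y p.2) \in r].

End Orderings.

Section SocialChoice.
Variables (X : finType) (n : nat).

Definition profile : Type := {ffun 'I_n -> ordering X}.

Implicit Types (u v : profile) (x y : X) (i j : 'I_n).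

Definition pareto_dominates u x y : bool := [forall i, above (u i) x y].

Definition pareto_correspondence u : {set X} :=
  [set x | ~~ [exists y, pareto_dominates u y x]].

Definition tops u : {set X} := [set x | [exists i, top_ranked (u i) x]].

Definition constructed_by_transposition u v x y i j : Prop :=
  [/\ immediately_above (u i) x y,
      immediately_above (u j) y x &
      forall k, val (v k) =
        if (k == i) || (k == j) then transpose x y (val (u k)) else val (u k)].

Definition social_choice_correspondence (G : profile -> {set X}) : Prop :=
  forall u, G u != set0.

Definition pareto_condition (G : profile -> {set X}) : Prop :=
  forall x y u, pareto_dominates u x y -> y \notin G u.

Definition tops_in (G : profile -> {set X}) : Prop :=
  forall u, tops u \subset G u.

Definition balanced (G : profile -> {set X}) : Prop :=
  forall x y u v i j, constructed_by_transposition u v x y i j -> G v = G u.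

End SocialChoice.

(* Main.v *)
Require Import Defs.
From mathcomp Require Import all_boot all_fingroup.

(** The Pareto condition gives one inclusion and tops-in handles the
alternatives that somebody ranks first, so the question is why a Pareto optimal
[y] that is nobody's top must be chosen.  Call the other alternatives [x] and
[z].  As [z] does not dominate [y], someone ranks [y] above [z], and since [y]
is not that individual's top, the ordering is [x > y > z].  As [x] does not
dominate [y] either, someone else has the ordering [z > y > x].  Transposing
[x] and [y] for these two individuals is a move that balancedness permits, and
it lifts [y] to the top of the first ordering ([runner_up_chosen]).  Tops-in
then puts [y] in the choice at the new profile, which is the choice at the
old one. *)

Section Orderings.
Set Implicit Arguments.
Unset Strict Implicit.
Variable X : finType.
Implicit Types (r : ordering X) (x y z : X).

Lemma above_total r x y : x != y -> above r x y || above r y x.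
Proof.
have /and3P[/forallP tot_r _ _] := valP r => neq_xy.
by apply: implyP neq_xy; apply: (forallP (tot_r x)).
Qed.

Lemma above_asym r x y : above r x y -> ~~ above r y x.
Proof.
have /and3P[_ /forallP asym_r _] := valP r.
by apply/implyP; apply: (forallP (asym_r x)).
Qed.

Lemma above_trans r y x z : above r x y -> above r y z -> above r x z.
Proof.
have /and3P[_ _ /forallP trans_r] := valP r; rewrite /above => xy yz.
have /forallP/(_ z)/implyP := forallP (trans_r x) y.
by rewrite xy yz; apply.
Qed.

Lemma above_irrefl r x : ~~ above r x x.
Proof. by apply/negP => xx; move/negP: (above_asym xx). Qed.

(** Exchanging two alternatives relabels the ordering by a permutation of [X],
and the three axioms do not depend on labels. *)
Lemma strong_ordering_transpose x y r :
  strong_ordering (transpose x y (val r)).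
Proof.
apply/and3P; split.
- apply/forallP => a; apply/forallP => b; apply/implyP => neq_ab.
  by rewrite !inE /=; apply: above_total; rewrite (inj_eq perm_inj).
- apply/forallP => a; apply/forallP => b; apply/implyP.
  by rewrite !inE /=; apply: above_asym.
- apply/forallP => a; apply/forallP => b; apply/forallP => c.
  by apply/implyP; rewrite !inE /= => /andP[]; apply: above_trans.
Qed.

Definition transpose_ordering x y r : ordering X :=
  exist _ (transpose x y (val r)) (strong_ordering_transpose x y r).

Lemma above_transpose x y r a b :
  above (transpose_ordering x y r) a b = above r (tperm x y a) (tperm x y b).
Proof. by rewrite /above /= inE. Qed.

Lemma top_ranked_transpose x y r :
  top_ranked r x -> top_ranked (transpose_ordering x y r) y.
Proof.
move=> /forallP top_x; apply/forallP => w; apply/implyP => neq_wy.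
rewrite above_transpose tpermR; apply: (implyP (top_x _)).
by rewrite -[X in _ != X](tpermR x y) (inj_eq perm_inj).
Qed.

(** With no alternatives besides [x], [y] and [z], a chain [x > y > z] is the
whole ordering. *)
Lemma three_chain r x y z :
    (forall w, [|| w == x, w == y | w == z]) -> above r x y -> above r y z ->
  [/\ top_ranked r x, immediately_above r x y & immediately_above r y z].
Proof.
move=> X3 xy yz; have xz := above_trans xy yz.
split.
- apply/forallP => w; apply/implyP.
  by case/or3P: (X3 w) => /eqP-> //; rewrite eqxx.
- rewrite /immediately_above xy; apply/existsP => -[w /andP[xw wy]].
  case/or3P: (X3 w) => /eqP eq_w; rewrite eq_w in xw wy.
  + by move: (above_irrefl r x); rewrite xw.
  + by move: (above_irrefl r y); rewrite wy.
  + by move: (above_asym yz); rewrite wy.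
- rewrite /immediately_above yz; apply/existsP => -[w /andP[yw wz]].
  case/or3P: (X3 w) => /eqP eq_w; rewrite eq_w in yw wz.
  + by move: (above_asym xy); rewrite yw.
  + by move: (above_irrefl r y); rewrite yw.
  + by move: (above_irrefl r z); rewrite wz.
Qed.

End Orderings.

Section SocialChoice.
Set Implicit Arguments.
Unset Strict Implicit.
Variables (X : finType) (n : nat) (G : profile X n -> {set X}).
Implicit Types (u : profile X n) (x y : X) (i j : 'I_n).

Lemma pareto_condition_sub u :
  pareto_condition G -> G u \subset pareto_correspondence u.
Proof.
move=> G_pareto; apply/subsetP => y Gy; rewrite inE.
by apply/existsP => -[x /G_pareto]; rewrite Gy.
Qed.

Definition transpose_profile u x y i j : profile X n :=
  [ffun k => if (k == i) || (k == j) then transpose_ordering x y (u k)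
             else u k].

(** Balancedness and tops-in together reach past the tops, for any number of
alternatives: a runner-up [y] of [i] is one transposition away from being a
top, and an individual [j] with [y] just above [x] supplies the compensating
transposition. *)
Lemma runner_up_chosen u x y i j :
    tops_in G -> balanced G -> top_ranked (u i) x ->
    immediately_above (u i) x y -> immediately_above (u j) y x ->
  y \in G u.
Proof.
move=> G_tops_in G_balanced top_x i_xy j_yx.
rewrite -(G_balanced x y u (transpose_profile u x y i j) i j).
  apply: (subsetP (G_tops_in _)); rewrite inE; apply/existsP; exists i.
  by rewrite ffunE eqxx; apply: top_ranked_transpose.
by split=> // k; rewrite ffunE; case: ifP.
Qed.

(** An individual who ranks [y] above [x] must still put something above [y],
which is not a top, and only [z] is left.  The theorem needs this for both
alternatives other than [y], to obtain the two opposite orderings. *)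
Lemma undominated_middle u x y z :
    (forall w, [|| w == x, w == y | w == z]) -> y != x ->
    y \notin tops u -> ~~ pareto_dominates u x y ->
  exists i, above (u i) z y /\ above (u i) y x.
Proof.
move=> X3 neq_yx not_top /forallPn[i not_xy].
have yx: above (u i) y x.
  by move: (above_total (u i) neq_yx); rewrite (negPf not_xy) orbF.
exists i; split=> //.
move: not_top; rewrite inE => /existsPn/(_ i)/forallPn[w].
rewrite negb_imply => /andP[neq_wy not_yw].
case/or3P: (X3 w) => /eqP eq_w; rewrite eq_w in neq_wy not_yw.
- by rewrite yx in not_yw.
- by rewrite eqxx in neq_wy.
- by move: (above_total (u i) neq_wy); rewrite (negPf not_yw) orbF.
Qed.

End SocialChoice.

Theorem theorem2 (X : finType) (n : nat) (G : profile X n -> {set X})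
    (card_X : #|X| = 3) (n_ge2 : 2 <= n)
    (G_scc : social_choice_correspondence G)
    (G_pareto : pareto_condition G)
    (G_tops_in : tops_in G)
    (G_balanced : balanced G) :
  forall u : profile X n, G u = pareto_correspondence u.
Proof.
move=> u; apply/eqP; rewrite eqEsubset pareto_condition_sub //=.
apply/subsetP => y; rewrite inE => /existsPn undom_y.
have [/(subsetP (G_tops_in u)) // | not_top] := boolP (y \in tops u).
have /eqP/cards2P[x [z [neq_xz others]]]: #|[set~ y]| = 2.
  by rewrite cardsC1 card_X.
have othersE w : (w != y) = (w == x) || (w == z).
  by move/setP/(_ w): others; rewrite !inE.
have neq_yx: y != x by rewrite eq_sym othersE eqxx.
have neq_yz: y != z by rewrite eq_sym othersE eqxx orbT.
have X3 w : [|| w == x, w == y | w == z].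
  by have := othersE w; case: (w == y); case: (w == x).
have X3' w : [|| w == z, w == y | w == x].
  by have := X3 w; case: (w == x); case: (w == y); case: (w == z).
have [i [i_xy i_yz]] :=
  undominated_middle X3' neq_yz not_top (undom_y z).
have [j [j_zy j_yx]] :=
  undominated_middle X3 neq_yx not_top (undom_y x).
have [top_x imm_xy _] := three_chain X3 i_xy i_yz.
have [_ _ imm_yx] := three_chain X3' j_zy j_yx.
exact: runner_up_chosen imm_xy imm_yx.
Qed.
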